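(* There exists a regular embedding of $P(\omega)/fin$ into $P(\omega)/\triangle_d$.
   Context: $\omega$ is the set of non-negative integers and $fin$ is the ideal of finite subsets of $\omega$. A set $A\subseteq\omega$ has asymptotic density zero if $\lim_{n\to\infty}\frac{|A\cap n|}{n}=0$ (where $n=\{0,\dots,n-1\}$); $\triangle_d$ is the ideal of subsets of $\omega$ of asymptotic density zero. $P(\omega)/fin$ and $P(\omega)/\triangle_d$ are the quotient Boolean algebras. A map $\phi\colon\mathbb{A}\to\mathbb{B}$ between Boolean algebras is a regular embedding iff (I) $\phi$ is a homomorphism, (II) $\phi$ is an embedding (injective), and (III) whenever $\mathcal{A}$ is a maximal antichain in $\mathbb{A}$, $\{\phi(A): A\in\mathcal{A}\}$ is a maximal antichain in $\mathbb{B}$. *)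

(* Defs.v *)
From HB Require Import structures.
From mathcomp Require Import all_boot all_order all_algebra.
From mathcomp Require Import finmap.
From mathcomp Require Import all_classical all_reals all_analysis.
Set Implicit Arguments.
Unset Strict Implicit.
Unset Printing Implicit Defensive.
Import Order.TTheory GRing.Theory Num.Theory.
Import numFieldNormedType.Exports.
Local Open Scope classical_set_scope.
Local Open Scope quotient_scope.

(** Boolean algebras are [ctbDistrLatticeType]s. *)

Section boolean_algebra.
Context {d : Order.disp_t} {B : ctbDistrLatticeType d}.

Definition antichain (X : set B) : Prop :=
  (forall x, X x -> x != \bot%O) /\
  (forall x y, X x -> X y -> x != y -> (x `&` y)%O = \bot%O).

Definition maximal_antichain (X : set B) : Prop :=
  antichain X /\ (forall Y, antichain Y -> X `<=` Y -> Y = X).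

End boolean_algebra.

Section regular_embedding.
Context {d d' : Order.disp_t}.
Context {A : ctbDistrLatticeType d} {B : ctbDistrLatticeType d'}.

Definition boolean_morphism (phi : A -> B) : Prop :=
  [/\ phi \bot%O = \bot%O, phi \top%O = \top%O,
      Order.meet_morphism phi, Order.join_morphism phi &
      {morph phi : x / (~` x)%O}].

Definition regular_embedding (phi : A -> B) : Prop :=
  [/\ boolean_morphism phi, injective phi &
      forall X : set A, maximal_antichain X -> maximal_antichain (phi @` X)].

End regular_embedding.

(** Ideals need not be proper. *)
Record set_ideal (T : Type) := SetIdeal {
  ideal_sets :> set (set T);
  ideal_set0 : ideal_sets set0;
  ideal_subset : forall A B, A `<=` B -> ideal_sets B -> ideal_sets A;
  ideal_setU : forall A B, ideal_sets A -> ideal_sets B -> ideal_sets (A `|` B)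
}.

Section ideal_quotient.
Context {T : Type} (I : set_ideal T).
Implicit Types A B C : set T.

Definition ideal_rel A B : bool := `[< ideal_sets I (A `+` B) >].

Let ideal_rel_refl : reflexive ideal_rel.
Proof. by move=> A; apply/asboolP; rewrite setYK; exact: ideal_set0. Qed.

Let ideal_rel_sym : symmetric ideal_rel.
Proof. by move=> A B; rewrite /ideal_rel setYC. Qed.

Let ideal_rel_trans : transitive ideal_rel.
Proof.
move=> B A C /asboolP AB /asboolP BC; apply/asboolP.
apply: (ideal_subset _ (ideal_setU AB BC)) => x.
by rewrite /setY /setU /setD /=; have [|] := pselect (B x); tauto.
Qed.

Definition ideal_equiv :=
  EquivRel ideal_rel ideal_rel_refl ideal_rel_sym ideal_rel_trans.

Definition ideal_quot : Type := {eq_quot ideal_equiv}.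

HB.instance Definition _ := Choice.on ideal_quot.
HB.instance Definition _ := EqQuotient.on ideal_quot.

Lemma ideal_quotP A B :
  \pi_ideal_quot A = \pi_ideal_quot B <-> ideal_sets I (A `+` B).
Proof.
by split=> [/eqmodP/asboolP//|AB]; apply/eqmodP/asboolP.
Qed.

Local Notation Q := ideal_quot.

(** The quotient operations act on representatives; they are well defined by
    [quot_meetE], [quot_joinE] and [quot_complE]. *)
Definition quot_meet : Q -> Q -> Q := lift_op2 Q (fun A B => A `&` B).
Definition quot_join : Q -> Q -> Q := lift_op2 Q (fun A B => A `|` B).
Definition quot_compl : Q -> Q := lift_op1 Q (fun A => ~` A).

Let repr_pi A : ideal_sets I (A `+` repr (\pi_Q A)).
Proof. by apply/ideal_quotP; rewrite reprK. Qed.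

Lemma quot_meetE A B : quot_meet (\pi_Q A) (\pi_Q B) = \pi_Q (A `&` B).
Proof.
rewrite /quot_meet -lock; apply/esym/ideal_quotP.
apply: (ideal_subset _ (ideal_setU (repr_pi A) (repr_pi B))) => x.
rewrite /setY /setU /setD /setI /=.
by have [|] := pselect (A x); have [|] := pselect (B x);
   have [|] := pselect (repr (\pi_Q A) x);
   have [|] := pselect (repr (\pi_Q B) x); tauto.
Qed.

Lemma quot_joinE A B : quot_join (\pi_Q A) (\pi_Q B) = \pi_Q (A `|` B).
Proof.
rewrite /quot_join -lock; apply/esym/ideal_quotP.
apply: (ideal_subset _ (ideal_setU (repr_pi A) (repr_pi B))) => x.
by rewrite /setY /setU /setD /setI /=; tauto.
Qed.

Lemma quot_complE A : quot_compl (\pi_Q A) = \pi_Q (~` A).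
Proof.
rewrite /quot_compl -lock; apply/esym/ideal_quotP.
apply: (ideal_subset _ (repr_pi A)) => x.
rewrite /setY /setU /setD /setC /=.
by have [|] := pselect (A x); have [|] := pselect (repr (\pi_Q A) x); tauto.
Qed.

Let quotE := (quot_meetE, quot_joinE, quot_complE).

Definition quot_le (x y : Q) : bool := quot_meet x y == x.
Definition quot_lt (x y : Q) : bool := (y != x) && quot_le x y.

Fact ideal_quot_display : Order.disp_t. Proof. exact: Order.Disp tt tt. Qed.

Let quot_meetC : commutative quot_meet.
Proof. by elim/quotW => A; elim/quotW => B; rewrite !quotE setIC. Qed.
Let quot_joinC : commutative quot_join.
Proof. by elim/quotW => A; elim/quotW => B; rewrite !quotE setUC. Qed.
Let quot_meetA : associative quot_meet.
Proof.
by elim/quotW => A; elim/quotW => B; elim/quotW => C; rewrite !quotE setIA.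
Qed.
Let quot_joinA : associative quot_join.
Proof.
by elim/quotW => A; elim/quotW => B; elim/quotW => C; rewrite !quotE setUA.
Qed.
Let quot_joinKI y x : quot_meet x (quot_join x y) = x.
Proof. by elim/quotW: x => A; elim/quotW: y => B; rewrite !quotE setUC setKU. Qed.
Let quot_meetKU y x : quot_join x (quot_meet x y) = x.
Proof. by elim/quotW: x => A; elim/quotW: y => B; rewrite !quotE setIC setKI. Qed.
Let quot_meetUl : left_distributive quot_meet quot_join.
Proof.
by elim/quotW => A; elim/quotW => B; elim/quotW => C; rewrite !quotE setIUl.
Qed.
Let quot_meetxx : idempotent_op quot_meet.
Proof. by elim/quotW => A; rewrite !quotE setIid. Qed.

HB.instance Definition _ :=
  Order.isMeetJoinDistrLattice.Build ideal_quot_display ideal_quot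
    (fun _ _ => erefl) (fun _ _ => erefl) quot_meetC quot_joinC
    quot_meetA quot_joinA quot_joinKI quot_meetKU quot_meetUl quot_meetxx.

Let quot_le0 (x : Q) : (\pi_Q set0 <= x)%O.
Proof. by elim/quotW: x => A; rewrite leEmeet /Order.meet /= quotE set0I. Qed.
Let quot_le1 (x : Q) : (x <= \pi_Q setT)%O.
Proof. by elim/quotW: x => A; rewrite leEmeet /Order.meet /= quotE setIT. Qed.

HB.instance Definition _ :=
  Order.hasBottom.Build ideal_quot_display ideal_quot quot_le0.
HB.instance Definition _ :=
  Order.hasTop.Build ideal_quot_display ideal_quot quot_le1.

Let quot_joinxC (x : Q) : (x `|` quot_compl x)%O = \top%O.
Proof. by elim/quotW: x => A; rewrite /Order.join /= !quotE setUCr. Qed.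
Let quot_meetxC (x : Q) : (x `&` quot_compl x)%O = \bot%O.
Proof. by elim/quotW: x => A; rewrite /Order.meet /= !quotE setICr. Qed.

HB.instance Definition _ :=
  Order.TBDistrLattice_hasComplement.Build ideal_quot_display ideal_quot
    quot_joinxC quot_meetxC.

Lemma pi_set0 : \pi_Q set0 = \bot%O. Proof. by []. Qed.
Lemma pi_setT : \pi_Q setT = \top%O. Proof. by []. Qed.
Lemma pi_setI A B : \pi_Q (A `&` B) = (\pi_Q A `&` \pi_Q B)%O.
Proof. by rewrite /Order.meet /= quotE. Qed.
Lemma pi_setU A B : \pi_Q (A `|` B) = (\pi_Q A `|` \pi_Q B)%O.
Proof. by rewrite /Order.join /= quotE. Qed.
Lemma pi_setC A : \pi_Q (~` A) = (~` \pi_Q A)%O.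
Proof. by rewrite -quot_complE. Qed.
Lemma pi_eq0 A : \pi_Q A = \bot%O <-> ideal_sets I A.
Proof.
rewrite -pi_set0; split=> [/ideal_quotP|IA].
  by rewrite setY0.
by apply/ideal_quotP; rewrite setY0.
Qed.

End ideal_quotient.

Fact fin_subset (A B : set nat) : A `<=` B -> finite_set B -> finite_set A.
Proof. exact: sub_finite_set. Qed.

Fact fin_setU (A B : set nat) :
  finite_set A -> finite_set B -> finite_set (A `|` B).
Proof. by move=> fA fB; rewrite finite_setU. Qed.

Definition fin_ideal : set_ideal nat :=
  @SetIdeal nat finite_set (finite_set0 nat) fin_subset fin_setU.

Section density.
Variable R : realType.
Local Open Scope ring_scope.

(** [`I_n] is [{0, ..., n-1}]; the term at [n = 0] is [0 / 0 = 0]. *)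
Definition initial_density (A : set nat) (n : nat) : R :=
  #|` fset_set (A `&` `I_n)|%:R / n%:R.

Definition density_zero (A : set nat) : Prop :=
  initial_density A @ \oo --> (0 : R).

Fact density_zero_set0 : density_zero set0.
Proof.
have E : initial_density set0 = fun=> 0.
  apply/funext => n.
  by rewrite /initial_density set0I fset_set0 cardfs0 mul0r.
rewrite /density_zero E; exact: cvg_cst.
Qed.

Let finI (A : set nat) n : finite_set (A `&` `I_n).
Proof. by apply: finite_setIr; exact: finite_II. Qed.

Let initial_density_ge0 A n : 0 <= initial_density A n.
Proof. by rewrite divr_ge0. Qed.

Fact density_zero_subset (A B : set nat) :
  A `<=` B -> density_zero B -> density_zero A.
Proof.
move=> AB B0; rewrite /density_zero.
apply: (squeeze_cvgr (f := fun=> 0) (h := initial_density B));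
  [|exact: cvg_cst|exact: B0].
near=> n; rewrite initial_density_ge0/=.
rewrite ler_wpM2r ?invr_ge0// ler_nat fsubset_leq_card//.
by rewrite -fset_set_sub//; exact: setSI.
Unshelve. all: by end_near. Qed.

Fact density_zero_setU (A B : set nat) :
  density_zero A -> density_zero B -> density_zero (A `|` B).
Proof.
move=> A0 B0; have := cvgD A0 B0; rewrite addr0 => AB0.
rewrite /density_zero.
apply: (squeeze_cvgr (f := fun=> 0)
    (h := initial_density A \+ initial_density B));
  [|exact: cvg_cst|exact: AB0].
near=> n; rewrite initial_density_ge0/= -mulrDl.
rewrite ler_wpM2r ?invr_ge0// -natrD ler_nat setIUl fset_setU//.
by rewrite cardfsU leq_subr.
Unshelve. all: by end_near. Qed.

Definition density_zero_ideal : set_ideal nat :=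
  @SetIdeal nat density_zero
    density_zero_set0 density_zero_subset density_zero_setU.

End density.

(* Main.v *)
Require Import Defs.
From mathcomp Require Import all_boot all_order all_algebra.
From mathcomp Require Import all_classical all_reals all_analysis.
From mathcomp Require Import finmap zify.

Import Order.TTheory GRing.Theory Num.Theory.
Import numFieldNormedType.Exports.
Local Open Scope classical_set_scope.
Local Open Scope quotient_scope.

(** Cut the natural numbers into the dyadic blocks [2^n, 2^(n+1)), with 0 added
    to the first one, and send the class of a set [A] to the class of the union
    of the blocks with index in [A].  This union is the preimage of [A] under
    [trunc_log 2], so Boolean operations are preserved on the level of sets, and
    only two points remain.

    First, [A] is finite if and only if its union of blocks has density zero;
    this makes the map well defined and injective.  Both directions come from
    [density_zero_dyadicP]: density zero can be tested on the proportion of a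
    set in each dyadic block, because the length of a block is half of its
    right endpoint.

    Secondly, maximal antichains are preserved.  Suppose that [B] does not have
    density zero.  By the same criterion, there are a [k] and an infinite set
    [A] of indices such that [B] fills more than 1/k of the n-th block for
    every [n] in [A].  For each infinite subset [C] of [A], the union of the
    blocks over [C] then meets [B] in a set that is still not of density zero
    ([density_positive_reduction]).  A maximal antichain has a member that
    meets [A] in an infinite set [C], so the image of that member meets the
    class of [B].  Hence no class can be added to the image of the
    antichain. *)

(** * Maximal antichains *)

(** Maximality amounts to predensity: an element that meets no member of [X]
    could be added to [X]; conversely, an element of a larger antichain meets
    some member of [X] and must then be equal to it.  This form quantifies over
    elements only, so it can be transported along a map. *)
Lemma maximal_antichainP {d : Order.disp_t} {B : ctbDistrLatticeType d}
    (X : set B) :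
  maximal_antichain X <->
  antichain X /\
  forall b, b != \bot%O -> exists2 x, X x & (x `&` b)%O != \bot%O.
Proof.
split=> [[aX maxX]|[aX predense]]; split=> //.
- move=> b b0; apply: contrapT => nomeet.
  have disj x : X x -> (x `&` b)%O = \bot%O.
    by move=> Xx; apply: contrapT => /eqP xb; apply: nomeet; exists x.
  have Xb : X b.
    rewrite -(maxX (b |` X)); [by left| |by right].
    split=> [x [->//|]|x y [->|Xx] [->|Xy]]; first exact: (aX.1 x).
    + by rewrite eqxx.
    + by move=> _; rewrite meetC disj.
    + by move=> _; rewrite disj.
    + exact: (aX.2 x y).
  by move: b0; rewrite -(meetxx b) disj// eqxx.
- move=> Y aY XY; apply/seteqP; split=> // y Yy.
  have [x Xx xy] := predense y (aY.1 y Yy).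
  suff -> : y = x by [].
  apply/eqP; apply: contraNT xy => yx.
  by rewrite meetC (aY.2 y x Yy (XY _ Xx) yx).
Qed.

(** * Preimage maps between quotients by ideals *)

Section preimage_map.
Context {T U : Type} (I : set_ideal T) (J : set_ideal U) (f : U -> T).

Definition preimage_quot (x : ideal_quot I) : ideal_quot J :=
  \pi_(ideal_quot J) (f @^-1` repr x).

(** Left to right, this makes the map well defined; right to left, it makes it
    injective. *)
Hypothesis preimage_ideal : forall A,
  ideal_sets I A <-> ideal_sets J (f @^-1` A).

Lemma preimage_quotE A :
  preimage_quot (\pi_(ideal_quot I) A) = \pi_(ideal_quot J) (f @^-1` A).
Proof.
apply/ideal_quotP; rewrite -[_ `+` _]/(f @^-1` (_ `+` A)).
by apply/preimage_ideal/ideal_quotP; rewrite reprK.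
Qed.

Lemma preimage_quot_morphism : boolean_morphism preimage_quot.
Proof.
split.
- by rewrite -pi_set0 preimage_quotE.
- by rewrite -pi_setT preimage_quotE.
- elim/quotW => A; elim/quotW => B.
  by rewrite -pi_setI !preimage_quotE -pi_setI.
- elim/quotW => A; elim/quotW => B.
  by rewrite -pi_setU !preimage_quotE -pi_setU.
- by elim/quotW => A; rewrite -pi_setC !preimage_quotE -pi_setC.
Qed.

Lemma preimage_quot_inj : injective preimage_quot.
Proof.
elim/quotW => A; elim/quotW => B.
rewrite !preimage_quotE => /ideal_quotP AB.
exact/ideal_quotP/preimage_ideal.
Qed.

(** A set [A] as in the hypothesis represents a reduction of the class of [B]:
    every nonzero class below that of [A] has an image meeting that of [B].  A
    member of a maximal antichain that meets the reduction has an image that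
    meets the class of [B], so predensity is preserved. *)
Lemma preimage_quot_regular :
  (forall B, ~ ideal_sets J B -> exists2 A, ~ ideal_sets I A &
     forall C, C `<=` A -> ~ ideal_sets I C ->
       ~ ideal_sets J (f @^-1` C `&` B)) ->
  regular_embedding preimage_quot.
Proof.
move=> reduction; have [p0 p1 pI pU pC] := preimage_quot_morphism.
split=> [//||X /maximal_antichainP [[X0 Xdisj] predense]].
  exact: preimage_quot_inj.
apply/maximal_antichainP; split; first split.
- move=> _ [x Xx <-]; rewrite -p0.
  by rewrite (inj_eq preimage_quot_inj); exact: X0.
- move=> _ _ [x Xx <-] [y Xy <-]; rewrite (inj_eq preimage_quot_inj) => xy.
  by rewrite -pI Xdisj.
- elim/quotW => B /eqP; rewrite pi_eq0 => /reduction [A IA redA].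
  have /predense [x Xx] : \pi_(ideal_quot I) A != \bot%O.
    by apply/eqP; rewrite pi_eq0.
  elim/quotW: x Xx => C XC; rewrite -pi_setI => /eqP; rewrite pi_eq0 => ICA.
  exists (preimage_quot (\pi_(ideal_quot I) C)); first by exists (\pi C).
  rewrite preimage_quotE -pi_setI; apply/eqP; rewrite pi_eq0 => JCB.
  apply: (redA _ (@subIsetr _ C A)) ICA _.
  by apply: ideal_subset JCB => u [[]].
Qed.

End preimage_map.

(** * Density zero through dyadic blocks *)

Lemma finite_set_nat_bounded (A : set nat) :
  finite_set A <-> exists n0, forall n, n0 <= n -> ~ A n.
Proof.
split=> [fA|[n0 An0]]; last first.
  apply: (@sub_finite_set _ _ `I_n0) (finite_II n0) => n An /=.
  by rewrite ltnNge; apply/negP => /An0.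
exists (\max_(i <- fset_set A) i).+1 => n nA An.
have : n \in fset_set A by rewrite in_fset_set// mem_set.
by move=> /(@leq_bigmax_seq _ _ xpredT id) /(_ isT); rewrite leqNgt nA.
Qed.

Definition count_between (A : set nat) (m n : nat) : nat :=
  \sum_(m <= i < n) (i \in A).

Lemma card_initial (A : set nat) n :
  #|` fset_set (A `&` `I_n)| = count_between A 0 n.
Proof.
rewrite /count_between; elim: n => [|n IHn].
  by rewrite II0 setI0 fset_set0 cardfs0 big_nil.
have finI m : finite_set (A `&` `I_m) by apply: finite_setIr; exact: finite_II.
rewrite big_nat_recr//= -IHn IIS setIUr.
case: (boolP (n \in A)) => [/set_mem An|nA].
  have -> : A `&` [set n] = [set n] by apply/setIidPr => _ ->.
  rewrite setUC fset_setU1// cardfsU1 in_fset_set// addnC.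
  suff -> : (n \in A `&` `I_n) = false by [].
  by apply/negbTE/negP => /set_mem [_ /=]; rewrite ltnn.
suff -> : A `&` [set n] = set0 by rewrite setU0 addn0.
apply/seteqP; split=> // m [Am mn]; move: nA.
by rewrite -mn (mem_set Am).
Qed.

(** Density zero as a statement about natural numbers, with [1/k] in the role
    of epsilon. *)
Lemma density_zeroP (R : realType) (A : set nat) :
  density_zero R A <->
  forall k, exists n0, forall n, n0 <= n -> k * count_between A 0 n <= n.
Proof.
have dE n : `|initial_density R A n|%R =
            ((count_between A 0 n)%:R / n%:R)%R.
  by rewrite /initial_density card_initial ger0_norm// divr_ge0.
split=> [A0 [|k]|small].
- by exists 0.
- have k0 : (0 < k.+1%:R^-1 :> R)%R by rewrite invr_gt0.
  have /cvgr0Pnorm_le/(_ _ k0) [N _ hN] := A0.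
  exists N.+1 => n Nn; have /= := hN n (ltnW Nn).
  have n0 : (0 < n%:R :> R)%R by rewrite ltr0n (leq_trans _ Nn).
  rewrite dE ler_pdivrMr// mulrC ler_pdivlMr//.
  by rewrite -natrM ler_nat mulnC.
- apply/cvgr0Pnorm_le => e e0.
  have [k ke] : exists k, (e^-1 <= k.+1%:R :> R)%R.
    exists (Num.truncn e^-1); apply/ltW; exact: truncnS_gt.
  have [n0 hn0] := small k.+1.
  exists n0.+1 => // n /= nn0; rewrite dE.
  have n_gt0 : (0 < n%:R :> R)%R by rewrite ltr0n (leq_trans _ nn0).
  rewrite ler_pdivrMr// -ler_pdivrMl//.
  apply: (@le_trans _ _ (k.+1%:R * (count_between A 0 n)%:R)%R).
    by rewrite ler_wpM2r.
  by rewrite -natrM ler_nat hn0// ltnW.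
Qed.

Lemma count_between_cat A m n p : m <= n -> n <= p ->
  count_between A m p = count_between A m n + count_between A n p.
Proof. by move=> mn np; rewrite /count_between (big_cat_nat mn np). Qed.

(** If the proportions in the blocks tend to zero, so do those in the initial
    segments: the blocks before a fixed one contribute a bounded amount, and
    the later ones a small proportion of a total length at most twice the
    length of the segment.  Conversely, a block makes up half of the initial
    segment that it completes, so its proportion is at most twice that of the
    segment. *)
Lemma density_zero_dyadicP (R : realType) (A : set nat) :
  density_zero R A <->
  forall k, finite_set [set n | 2 ^ n < k * count_between A (2 ^ n) (2 ^ n.+1)].
Proof.
rewrite density_zeroP; split=> small k.
- apply/finite_set_nat_bounded; have [n0 hn0] := small k.*2.
  exists n0 => n nn0 /=; apply/negP; rewrite -leqNgt.
  have n0le : n0 <= 2 ^ n.+1.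
    by apply: leq_trans nn0 _; rewrite ltnW// ltnW// ltn_expl.
  have := hn0 _ n0le; rewrite (@count_between_cat _ _ (2 ^ n))//.
    by rewrite expnS; nia.
  by rewrite leq_exp2l.
- (* The complete blocks covering [0, m) have total length at most 2 * m; the
     factor 3 leaves a further m for the blocks before n0. *)
  have /finite_set_nat_bounded [n0 hn0] := small (3 * k).
  (* Scaled by 3 * k, the count in the blocks from n0 up to n is at most the sum
     of their lengths, which is below 2 ^ n. *)
  have pow n : n0 <= n ->
      3 * k * count_between A 0 (2 ^ n) <=
      3 * k * count_between A 0 (2 ^ n0) + 2 ^ n.
    elim: n => [|n IHn]; first by rewrite leqn0 => /eqP ->; rewrite leq_addr.
    rewrite leq_eqVlt => /predU1P [->|]; first by rewrite leq_addr.
    rewrite ltnS => n0n.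
    have /negP := hn0 n n0n; rewrite -leqNgt => blk.
    rewrite (@count_between_cat _ _ (2 ^ n))// ?leq_exp2l//.
    by have := leq_add (IHn n0n) blk; rewrite mulnDr expnS -addnA addnn mul2n.
  exists (2 ^ n0 + 3 * k * count_between A 0 (2 ^ n0)) => m mbig.
  have m0 : 0 < m by apply: leq_trans mbig; rewrite addn_gt0 expn_gt0.
  have /andP [lo hi] := trunc_log_bounds (isT : 1 < 2) m0.
  have n0m : n0 <= trunc_log 2 m.
    by apply: trunc_log_max => //; apply: leq_trans mbig; rewrite leq_addr.
  have initial_le : 3 * k * count_between A 0 m <=
                    3 * k * count_between A 0 (2 ^ (trunc_log 2 m).+1).
    rewrite leq_mul2l (@count_between_cat A _ _ _ (leq0n m) (ltnW hi)) leq_addr.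
    by rewrite orbT.
  have := leq_trans initial_le (pow _ (leqW n0m)).
  rewrite expnS -!mulnA in mbig *.
  clear hn0 pow initial_le.
  lia.
Qed.

(** * The embedding *)

Lemma eq_count_between A B m n : (forall i, m <= i < n -> A i <-> B i) ->
  count_between A m n = count_between B m n.
Proof.
move=> AB; apply: eq_big_nat => i /AB ABi.
by congr nat_of_bool; apply/idP/idP => /set_mem/ABi/mem_set.
Qed.

Lemma count_preimage_log_block A B n :
  count_between (trunc_log 2 @^-1` A `&` B) (2 ^ n) (2 ^ n.+1) =
  (n \in A) * count_between B (2 ^ n) (2 ^ n.+1).
Proof.
case: (boolP (n \in A)) => [/set_mem|] An; rewrite ?mul1n ?mul0n.
  apply: eq_count_between => i /(trunc_log_eq (isT : 1 < 2)) logi.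
  by split=> [[]|Bi] //; split=> //=; rewrite logi.
rewrite /count_between big_nat big1// => i.
move=> /(trunc_log_eq (isT : 1 < 2)) logi.
case: (boolP (i \in _)) => // /set_mem [/= + _].
by rewrite logi => /mem_set; rewrite (negbTE An).
Qed.

(** In its dyadic blocks, the preimage has proportion 1 at the indices in [A]
    and 0 elsewhere. *)
Lemma finite_density_zero_preimage_log (R : realType) (A : set nat) :
  finite_set A <-> density_zero R (trunc_log 2 @^-1` A).
Proof.
have blkE n : count_between (trunc_log 2 @^-1` A) (2 ^ n) (2 ^ n.+1) =
              (n \in A) * 2 ^ n.
  rewrite -[X in count_between X]setIT count_preimage_log_block.
  congr (_ * _); rewrite /count_between.
  under eq_bigr do rewrite in_setT.
  by rewrite sum_nat_const_nat muln1 expnS; lia.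
rewrite density_zero_dyadicP; split=> [fA k|/(_ 2)]; last first.
  apply: sub_finite_set => n /mem_set An /=.
  by rewrite blkE An mul1n mul2n -addnn -addn1 leq_add2l expn_gt0.
apply: sub_finite_set fA => n /=; rewrite blkE.
by case: (boolP (n \in A)) => [/set_mem//|_]; rewrite mul0n muln0.
Qed.

(** [A] collects the blocks of which [B] fills more than the proportion [1/k],
    for some [k] for which there are infinitely many of them.  In the blocks
    with index in [C], the intersection keeps all of [B]. *)
Lemma density_positive_reduction (R : realType) (B : set nat) :
  ~ density_zero R B -> exists2 A, ~ finite_set A &
    forall C, C `<=` A -> ~ finite_set C ->
      ~ density_zero R (trunc_log 2 @^-1` C `&` B).
Proof.
move=> /density_zero_dyadicP /existsNP [k infA].
exists [set n | 2 ^ n < k * count_between B (2 ^ n) (2 ^ n.+1)] => // C CA infC.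
move=> /density_zero_dyadicP /(_ k) fin; apply: infC.
apply: sub_finite_set fin => n Cn /=.
by rewrite count_preimage_log_block (mem_set Cn) mul1n; exact: CA.
Qed.

Theorem proposition1 (R : realType) :
  exists phi : ideal_quot fin_ideal -> ideal_quot (density_zero_ideal R),
    regular_embedding phi.
Proof.
exists (preimage_quot fin_ideal (density_zero_ideal R) (trunc_log 2)).
apply: preimage_quot_regular => [A|B].
  exact: finite_density_zero_preimage_log.
exact: density_positive_reduction.
Qed.
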